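(* The problem List $k$-Coloring restricted to bipartite graphs of diameter at most $2$ (i.e. complete bipartite graphs) can be solved in time $\mathcal{O}(2^k \cdot k\cdot\log k \cdot n)$, where $n$ is the number of vertices of the input graph. In particular, it can be solved in linear time for every fixed integer $k \geq 1$.
   Context: All graphs are finite and simple. The diameter of a graph is the maximum distance between any pair of its vertices (a disconnected graph has infinite diameter). Write $[k]=\{1,\dots,k\}$. The decision problem List $k$-Coloring is: given a graph $G=(V,E)$ and a list assignment $L$ such that $L(u)\subseteq[k]$ for every $u\in V(G)$, does $G$ admit a proper coloring $f$ (that is, $f(u)\neq f(v)$ for every edge $uv$) such that $f(u)\in L(u)$ for every $u\in V(G)$? The constant hidden in the $\mathcal{O}$-notation does not depend on $k$, on $n$ or on the input. In the time bound, $\log k$ is understood to be at least $1$. *)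

(* Defs.v *)
From mathcomp Require Import all_boot.

Set Implicit Arguments.
Unset Strict Implicit.
Unset Printing Implicit Defensive.

(** * Graphs and list colorings

    A graph on the vertex set [V] is given by its adjacency relation. *)

Section Graphs.
Variables (V : finType) (e : rel V).

Definition simple_graph : Prop := symmetric e /\ irreflexive e.

Definition bipartite : Prop :=
  exists A : {set V}, forall u v, e u v -> (u \in A) != (v \in A).

Definition has_walk (l : nat) (u v : V) : bool :=
  [exists p : l.-tuple V, path e u p && (last u p == v)].

(** The least length of a walk from [u] to [v]; meaningful only when [v] is
    reachable from [u], in which case this length is less than [#|V|]. *)
Definition dist (u v : V) : nat := find (fun l => has_walk l u v) (iota 0 #|V|).

(** [None] is the infinite diameter of a disconnected graph. *)
Definition diameter : option nat :=
  if [forall u, forall v, connect e u v]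
  then Some (\max_(u : V) \max_(v : V) dist u v) else None.

Definition diameter_at_most (d : nat) : Prop :=
  if diameter is Some m then m <= d else False.

(** The color set [{1, ..., k}] is rendered as ['I_k]. *)
Definition list_colorable (k : nat) (L : V -> {set 'I_k}) : Prop :=
  exists f : V -> 'I_k,
    (forall u v, e u v -> f u != f v) /\ (forall u, f u \in L u).

End Graphs.

(** * Word RAM

    The registers (a program names finitely many of them), a random-access work
    memory and a read-only random-access input hold [w]-bit words.  Every
    elementary operation and every test costs one step.  The only arithmetic is
    addition modulo [2 ^ w] and truncated subtraction. *)

Definition reg := nat.

Inductive cmd : Type :=
| Skip
| Const (d : reg) (c : nat)
| Add (d a b : reg)
| Sub (d a b : reg)
| ReadInput (d a : reg)
| ReadMem (d a : reg)
| WriteMem (a b : reg)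
| Seq (p q : cmd)
| If (a : reg) (p q : cmd)
| While (a : reg) (p : cmd).

Record state := State { regs : reg -> nat; cells : nat -> nat }.

Definition init_state : state := State (fun=> 0) (fun=> 0).

Definition update (f : nat -> nat) (a x : nat) : nat -> nat :=
  fun b => if b == a then x else f b.

Definition set_reg (s : state) (d : reg) (x : nat) : state :=
  State (update (regs s) d x) (cells s).

Definition set_cell (s : state) (a x : nat) : state :=
  State (regs s) (update (cells s) a x).

(** [exec w inp p s t s']: with word length [w] and input [inp], the program [p]
    started in [s] terminates in [s'] after exactly [t] steps.  Input cells
    beyond the end of [inp] read as [0]. *)
Inductive exec (w : nat) (inp : seq nat) : cmd -> state -> nat -> state -> Prop :=
| ExecSkip s : exec w inp Skip s 1 s
| ExecConst d c s :
    exec w inp (Const d c) s 1 (set_reg s d (c %% 2 ^ w))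
| ExecAdd d a b s :
    exec w inp (Add d a b) s 1 (set_reg s d ((regs s a + regs s b) %% 2 ^ w))
| ExecSub d a b s :
    exec w inp (Sub d a b) s 1 (set_reg s d (regs s a - regs s b))
| ExecReadInput d a s :
    exec w inp (ReadInput d a) s 1 (set_reg s d (nth 0 inp (regs s a) %% 2 ^ w))
| ExecReadMem d a s :
    exec w inp (ReadMem d a) s 1 (set_reg s d (cells s (regs s a)))
| ExecWriteMem a b s :
    exec w inp (WriteMem a b) s 1 (set_cell s (regs s a) (regs s b))
| ExecSeq p q s1 s2 s3 t1 t2 :
    exec w inp p s1 t1 s2 -> exec w inp q s2 t2 s3 ->
    exec w inp (Seq p q) s1 (t1 + t2) s3
| ExecIfT a p q s s' t :
    regs s a != 0 -> exec w inp p s t s' -> exec w inp (If a p q) s t.+1 s'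
| ExecIfF a p q s s' t :
    regs s a = 0 -> exec w inp q s t s' -> exec w inp (If a p q) s t.+1 s'
| ExecWhileF a p s :
    regs s a = 0 -> exec w inp (While a p) s 1 s
| ExecWhileT a p s1 s2 s3 t1 t2 :
    regs s1 a != 0 -> exec w inp p s1 t1 s2 ->
    exec w inp (While a p) s2 t2 s3 ->
    exec w inp (While a p) s1 (t1 + t2).+1 s3.

Lemma exec_deterministic w inp p s t1 s1 t2 s2 :
  exec w inp p s t1 s1 -> exec w inp p s t2 s2 -> t1 = t2 /\ s1 = s2.
Proof.
move=> H; elim: H t2 s2 => {p s t1 s1};
  try by [move=> * ; match goal with h : exec _ _ _ _ _ _ |- _ => inversion h end].
- move=> p q s1 s2 s3 t1 t2 _ IHp _ IHq t s H.
  inversion H as [| | | | | | |? ? ? s2' ? ? ? Hp Hq| | | |]; subst.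
  by case: (IHp _ _ Hp) => -> E; subst; case: (IHq _ _ Hq) => -> ->.
- move=> a p q s s' t nz _ IH t2 s2 H.
  inversion H as [| | | | | | | |? ? ? ? ? ? _ Hp|? ? ? ? ? ? z _| |]; subst.
    by case: (IH _ _ Hp) => -> ->.
  by rewrite z in nz.
- move=> a p q s s' t z _ IH t2 s2 H.
  inversion H as [| | | | | | | |? ? ? ? ? ? nz _|? ? ? ? ? ? _ Hq| |]; subst.
    by rewrite z in nz.
  by case: (IH _ _ Hq) => -> ->.
- move=> a p s z t2 s2 H.
  inversion H as [| | | | | | | | | |? ? ? _|? ? ? ? ? ? ? nz _ _]; subst => //.
  by rewrite z in nz.
- move=> a p s1 s2 s3 t1 t2 nz _ IHp _ IHw t s H.
  inversion H as [| | | | | | | | | |? ? ? z|? ? ? s2' ? ? ? _ Hp Hw]; subst.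
    by rewrite z in nz.
  by case: (IHp _ _ Hp) => -> E; subst; case: (IHw _ _ Hw) => -> ->.
Qed.

(** * Encoding of instances *)

(** [ls] lists, for every index, the elements of the corresponding set, in an
    arbitrary order and without repetition. *)
Definition lists_of (I T : finType) (S : I -> {pred T}) (ls : I -> seq T) : Prop :=
  forall i, uniq (ls i) /\ ls i =i S i.

(** The input array starts with [n] and [k], followed by a table of [2 * n]
    addresses of blocks: cell [2 + v] holds the address of the adjacency list of
    the vertex [v], and cell [2 + n + v] the address of its list of colors.
    A block is the length of a list followed by its elements. *)
Definition block (m : nat) (s : seq 'I_m) : seq nat := size s :: map val s.

Definition encode (n k : nat)
    (nbrs : 'I_n -> seq 'I_n) (cols : 'I_n -> seq 'I_k) : seq nat :=
  let bs := [seq block (nbrs v) | v <- enum 'I_n] ++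
            [seq block (cols v) | v <- enum 'I_n] in
  [:: n; k] ++
  [seq 2 + size bs + sumn (take i (shape bs)) | i <- iota 0 (size bs)] ++
  flatten bs.

(** * Solving list coloring on a graph class *)

Definition graph_class := forall n : nat, rel 'I_n -> Prop.

Definition bipartite_diameter_at_most_2 : graph_class :=
  fun n e => bipartite e /\ diameter_at_most e 2.

(** [p] decides List [k]-Coloring restricted to the class [cls] in time [T n],
    [n] being the number of vertices (at least one).  The inputs outside [cls]
    are unconstrained.  The words have [w >= c * log2 (n + k)] bits.  The answer
    is "yes" when register [0] is nonzero at the end. *)
Definition solves_list_coloring
    (cls : graph_class) (k : nat) (p : cmd) (c : nat) (T : nat -> nat) : Prop :=
  forall (n : nat) (e : rel 'I_n) (L : 'I_n -> {set 'I_k})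
         (nbrs : 'I_n -> seq 'I_n) (cols : 'I_n -> seq 'I_k) (w : nat),
    0 < n -> simple_graph e -> cls n e ->
    lists_of e nbrs -> lists_of (fun v => mem (L v)) cols ->
    (n + k) ^ c <= 2 ^ w ->
    exists (t : nat) (s : state),
      [/\ exec w (encode nbrs cols) p init_state t s,
          t <= T n
        & regs s 0 != 0 <-> list_colorable e L].

(** The logarithm in base 2, rounded down and understood to be at least 1. *)
Definition log_ge1 (k : nat) : nat := maxn 1 (trunc_log 2 k).

(* Main.v *)
(** In a connected bipartite graph of diameter at most 2 the sides are the
    neighbors and the non-neighbors of any fixed vertex [x], and all edges between
    them are present.  Such a graph is list colorable iff the colors split into a
    set [S] and its complement such that every non-neighbor of [x] has a color of
    its list in [S] and every neighbor has one outside [S].  The program marks the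
    neighbors of the vertex [0] and tries all [2 ^ k] sets [S].  As [2 ^ k] may
    exceed the word size, [S] is a bit array, incremented as a binary counter; each
    set is tested in time [O(k * n)]. *)

From mathcomp Require Import all_boot zify.
Require Import Defs.

Set Implicit Arguments.
Unset Strict Implicit.
Unset Printing Implicit Defensive.

Arguments update _ _ _ / _.

(** * Timed total correctness *)

Section Run.
Variables (w : nat) (inp : seq nat).

Definition run (p : cmd) (s : state) (T : nat) (Q : state -> Prop) : Prop :=
  exists t s', [/\ exec w inp p s t s', t <= T & Q s'].

Lemma run_conseq p s T (Q Q' : state -> Prop) :
  run p s T Q -> (forall s', Q s' -> Q' s') -> run p s T Q'.
Proof. by move=> [t [s' [ex le_t q]]] sub; exists t, s'; split=> //; exact: sub. Qed.

Lemma run_weaken p s T T' Q : run p s T Q -> T <= T' -> run p s T' Q.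
Proof. by move=> [t [s' [ex le_t q]]] le_T; exists t, s'; split=> //; exact: leq_trans le_T. Qed.

Lemma run_skip s T (Q : state -> Prop) : Q s -> run Skip s T.+1 Q.
Proof. by move=> q; exists 1, s; split=> //; constructor. Qed.

Lemma run_const d c s T (Q : state -> Prop) :
  c < 2 ^ w -> Q (set_reg s d c) -> run (Const d c) s T.+1 Q.
Proof.
move=> lt_c q; exists 1, (set_reg s d c); split=> //.
by rewrite -[in set_reg _ _ _](modn_small lt_c); constructor.
Qed.

Lemma run_add d a b s T (Q : state -> Prop) :
  regs s a + regs s b < 2 ^ w -> Q (set_reg s d (regs s a + regs s b)) ->
  run (Add d a b) s T.+1 Q.
Proof.
move=> lt_c q; exists 1, (set_reg s d (regs s a + regs s b)); split=> //.
by rewrite -[in set_reg _ _ _](modn_small lt_c); constructor.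
Qed.

Lemma run_sub d a b s T (Q : state -> Prop) :
  Q (set_reg s d (regs s a - regs s b)) -> run (Sub d a b) s T.+1 Q.
Proof. by move=> q; eexists 1, _; split; [constructor| |exact: q]. Qed.

Lemma run_read_input d a s T (Q : state -> Prop) :
  nth 0 inp (regs s a) < 2 ^ w -> Q (set_reg s d (nth 0 inp (regs s a))) ->
  run (ReadInput d a) s T.+1 Q.
Proof.
move=> lt_c q; exists 1, (set_reg s d (nth 0 inp (regs s a))); split=> //.
by rewrite -[in set_reg _ _ _](modn_small lt_c); constructor.
Qed.

Lemma run_read_mem d a s T (Q : state -> Prop) :
  Q (set_reg s d (cells s (regs s a))) -> run (ReadMem d a) s T.+1 Q.
Proof. by move=> q; eexists 1, _; split; [constructor| |exact: q]. Qed.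

Lemma run_write_mem a b s T (Q : state -> Prop) :
  Q (set_cell s (regs s a) (regs s b)) -> run (WriteMem a b) s T.+1 Q.
Proof. by move=> q; eexists 1, _; split; [constructor| |exact: q]. Qed.

(** The run of [q] is the postcondition of [p], so a program is executed symbolically from left to
    right while its time budget is split along the way. *)
Lemma run_seq p q s T1 T2 Q :
  run p s T1 (fun s1 => run q s1 T2 Q) -> run (Seq p q) s (T1 + T2) Q.
Proof.
move=> [t1 [s1 [ex1 le1 [t2 [s2 [ex2 le2 q2]]]]]]; exists (t1 + t2), s2.
by split=> //; [exact: ExecSeq ex1 ex2 | exact: leq_add].
Qed.

Lemma run_step p q s T Q :
  run p s 1 (fun s1 => run q s1 T Q) -> run (Seq p q) s T.+1 Q.
Proof. by rewrite -add1n; exact: run_seq. Qed.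

Lemma run_if a p q s T Q :
  (regs s a != 0 -> run p s T Q) -> (regs s a = 0 -> run q s T Q) ->
  run (If a p q) s T.+1 Q.
Proof.
move=> hp hq; case: (eqVneq (regs s a) 0) => [z|nz].
  have [t [s' [ex le_t post]]] := hq z; exists t.+1, s'; split=> //.
  exact: ExecIfF.
have [t [s' [ex le_t post]]] := hp nz; exists t.+1, s'; split=> //.
exact: ExecIfT.
Qed.

End Run.

(** * Frame conditions and loop rules *)

Fixpoint writes (p : cmd) (r : reg) : bool :=
  match p with
  | Const d _ | Add d _ _ | Sub d _ _ | ReadInput d _ | ReadMem d _ => r == d
  | Seq p q | If _ p q => writes p r || writes q r
  | While _ p => writes p r
  | Skip | WriteMem _ _ => false
  end.

Fixpoint writes_mem (p : cmd) : bool :=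
  match p with
  | WriteMem _ _ => true
  | Seq p q | If _ p q => writes_mem p || writes_mem q
  | While _ p => writes_mem p
  | _ => false
  end.

(** The frame condition of [p]. Both tests are syntactic, so for a concrete program and register the
    side condition holds by computation, with proof [isT]. *)
Definition same (p : cmd) (s s' : state) : Prop :=
  (forall r, ~~ writes p r -> regs s' r = regs s r) /\
  (~~ writes_mem p -> cells s' = cells s).

Lemma same_trans p s1 s2 s3 : same p s1 s2 -> same p s2 s3 -> same p s1 s3.
Proof.
move=> [r12 c12] [r23 c23]; split=> [r wr|wc]; first by rewrite r23 // r12.
by rewrite c23 // c12.
Qed.

Lemma same_exec w inp p s t s' : exec w inp p s t s' -> same p s s'.
Proof.
elim=> {p s t s'} //;
  try by move=> *; split=> //= r; rewrite /update; case: eqP.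
- move=> p q s1 s2 s3 t1 t2 _ [r12 c12] _ [r23 c23].
  split=> [r|] /=; rewrite negb_or => /andP[np nq]; first by rewrite r23 // r12.
  by rewrite c23 // c12.
- move=> a p q s s' t _ _ [rp cp].
  by split=> [r|] /=; rewrite negb_or => /andP[np nq]; [exact: rp|exact: cp].
- move=> a p q s s' t _ _ [rp cp].
  by split=> [r|] /=; rewrite negb_or => /andP[np nq]; [exact: rp|exact: cp].
- by move=> a p s1 s2 s3 t1 t2 _ _ h1 _ h2; exact: same_trans h1 h2.
Qed.

(** [I i] is the invariant after [i] rounds. Each round pays one step for its test, and the last,
    failing test pays the final step. The frame [same p s0 s] is handed to every round, so [I] only
    has to mention what the body changes. *)
Lemma run_while w inp a p s0 (I : nat -> state -> Prop) N B :
  I 0 s0 ->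
  (forall i s, i < N -> same p s0 s -> I i s ->
     regs s a != 0 /\ run w inp p s B (I i.+1)) ->
  (forall s, same p s0 s -> I N s -> regs s a = 0) ->
  run w inp (While a p) s0 (N * B.+1).+1 (fun s => same p s0 s /\ I N s).
Proof.
move=> I0 body final.
(* Induction on the number [j] of rounds still to come. *)
suff H j s : j <= N -> same p s0 s -> I (N - j) s ->
    run w inp (While a p) s (j * B.+1).+1 (fun s => same p s0 s /\ I N s).
  by apply: H; rewrite ?subnn.
elim: j s => [|j IHj] s le_j ss Is.
  rewrite subn0 in Is; exists 1, s; split=> //.
  by apply: ExecWhileF; exact: final.
have lt_i : N - j.+1 < N by lia.
have [nz [t1 [s1 [ex1 le1 I1]]]] := body _ _ lt_i ss Is.
have ss1 : same p s0 s1 by apply: same_trans ss (same_exec ex1).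
have eN : (N - j.+1).+1 = N - j by lia.
rewrite eN in I1.
have [t2 [s2 [ex2 le2 post]]] := IHj s1 (ltnW le_j) ss1 I1.
exists (t1 + t2).+1, s2; split=> //; first exact: ExecWhileT ex1 ex2.
by rewrite ltnS mulSn; lia.
Qed.

Notation "p ;; q" := (Seq p q) (at level 61, right associativity).

Notation rAns := 0 (only parsing).
Notation rOne := 1 (only parsing).
Notation rN := 2 (only parsing).
Notation rK := 3 (only parsing).
Notation rGo := 4 (only parsing).
Notation rLeft := 5 (only parsing).
Notation rV := 6 (only parsing).
Notation rPtr := 7 (only parsing).
Notation rLen := 8 (only parsing).
Notation rX := 9 (only parsing).
Notation rFlag := 10 (only parsing).
Notation rAll := 11 (only parsing).
Notation rSide := 12 (only parsing).
(* Never written, hence always 0. *)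
Notation rZero := 13 (only parsing).

Definition count_down (a : reg) (p : cmd) : cmd := While a (p ;; Sub a a rOne).

(** Since [p] writes neither the counter nor [rOne], the counter is [N - i] after [i] rounds. A
    round costs two steps more than [p]: the decrement and the test. The invariant is required after
    the decrement, hence the [set_reg] in the postcondition. *)
Lemma run_count_down w inp a p s0 (I : nat -> state -> Prop) N B :
  ~~ writes p a -> ~~ writes p rOne -> a != rOne ->
  regs s0 rOne = 1 -> regs s0 a = N -> I 0 s0 ->
  (forall i s, i < N -> same (count_down a p) s0 s -> I i s ->
     run w inp p s B (fun s' => I i.+1 (set_reg s' a (N - i.+1)))) ->
  run w inp (count_down a p) s0 (N * B.+2).+1
    (fun s => same (count_down a p) s0 s /\ I N s).
Proof.
move=> wa w1 a1 one_s0 a_s0 I0 body.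
have H := @run_while w inp a (p ;; Sub a a rOne) s0
  (fun i s => regs s a = N - i /\ I i s) N B.+1.
apply: (run_conseq (H _ _ _)) => [|i s lt_i ss [a_s Is]|s _ [-> _]|s [ss []]] //.
- by rewrite subn0.
- split; first by rewrite a_s; lia.
  have [t [s' [ex le_t post]]] := body i s lt_i ss Is.
  have [r' _] := same_exec ex.
  have one_s' : regs s' rOne = 1.
    case: ss => rr _; rewrite r' // rr //= negb_or w1.
    by rewrite eq_sym.
  have a_s' : regs s' a - regs s' rOne = N - i.+1.
    by rewrite r' // a_s one_s'; lia.
  exists (t + 1), (set_reg s' a (regs s' a - regs s' rOne)); split.
  + by apply: ExecSeq ex _; constructor.
  + by rewrite addn1.
  + by rewrite a_s' /= /update eqxx.
- by rewrite subnn.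
Qed.

(** * The program *)

(* Cell [v < n] of the memory is 1 iff [v] is a neighbor of the vertex [0]; cell
   [n + c] is the bit of the color [c] in the current set. *)

Definition mark_sides : cmd :=
  count_down rLen (Add rPtr rPtr rOne ;; ReadInput rX rPtr ;; WriteMem rX rOne).

(** [rX] receives the bit of the color, complemented if [rSide] is 1, that is, for a neighbor of the
    vertex 0; the value 1 then means that the color is usable. *)
Definition scan_colors : cmd :=
  count_down rLen
    (Add rPtr rPtr rOne ;; ReadInput rX rPtr ;; Add rX rX rN ;; ReadMem rX rX ;;
     If rSide (Sub rX rOne rX) Skip ;; If rX (Const rFlag 1) Skip).

Definition scan_vertices : cmd :=
  count_down rLeft
    (Const rFlag 0 ;; Const rPtr 2 ;; Add rPtr rPtr rN ;; Add rPtr rPtr rV ;;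
     ReadInput rPtr rPtr ;; ReadInput rLen rPtr ;; ReadMem rSide rV ;;
     scan_colors ;;
     If rFlag Skip (Const rAll 0) ;; Add rV rV rOne).

(** [rFlag] is the carry. All [k] bits are visited, even after the carry has been absorbed. *)
Definition increment : cmd :=
  count_down rLen
    (If rFlag
       (ReadMem rX rPtr ;;
        If rX (WriteMem rPtr rZero) (WriteMem rPtr rOne ;; Const rFlag 0))
       Skip ;;
     Add rPtr rPtr rOne).

(** The carry left by [increment] is 1 only when the counter overflows; this clears [rGo] and ends
    the enumeration. *)
Definition try_subset : cmd :=
  Const rAll 1 ;; Const rV 0 ;; Add rLeft rN rZero ;; scan_vertices ;;
  If rAll (Const rAns 1) Skip ;;
  Const rFlag 1 ;; Add rPtr rN rZero ;; Add rLen rK rZero ;; increment ;;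
  Sub rGo rOne rFlag.

Definition solver : cmd :=
  Const rOne 1 ;; ReadInput rN rZero ;; ReadInput rK rOne ;;
  Const rPtr 2 ;; ReadInput rPtr rPtr ;; ReadInput rLen rPtr ;; mark_sides ;;
  Const rGo 1 ;; While rGo try_subset.

(** * Sets of colors as binary numbers *)

Definition bits_val (k : nat) (B : nat -> bool) : nat := \sum_(j < k) B j * 2 ^ j.

Lemma bits_valS k B : bits_val k.+1 B = B 0 + 2 * bits_val k (B \o succn).
Proof.
rewrite /bits_val big_ord_recl muln1 big_distrr /=; congr (_ + _).
by apply: eq_bigr => j _; rewrite /= /bump /= add1n expnS mulnCA.
Qed.

Lemma bits_val_lt k B : bits_val k B < 2 ^ k.
Proof.
elim: k B => [|k IHk] B; first by rewrite /bits_val big_ord0.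
by rewrite bits_valS expnS; have := IHk (B \o succn); case: (B 0) => /=; lia.
Qed.

(** The parity of the number determines the lowest bit, and induction does the rest. Testing the one
    set stored in the counter therefore settles every [B] with the same number. *)
Lemma bits_val_inj k B B' :
  bits_val k B = bits_val k B' -> forall j, j < k -> B j = B' j.
Proof.
elim: k B B' => [//|k IHk] B B'; rewrite !bits_valS => eqv.
have eq0 : B 0 = B' 0 by move: eqv; case: (B 0); case: (B' 0) => //=; lia.
case=> [//|j]; rewrite ltnS => lt_j.
by apply: (IHk (B \o succn) (B' \o succn)) => //; rewrite eq0 in eqv; lia.
Qed.

Lemma bits_val_update k (B : nat -> bool) i b : i < k ->
  bits_val k (fun j => if j == i then b else B j) + B i * 2 ^ i
  = bits_val k B + b * 2 ^ i.
Proof.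
move=> lt_i; pose o := Ordinal lt_i.
rewrite /bits_val (bigD1 o) //= eqxx [in RHS](bigD1 o) //=.
rewrite (eq_bigr (fun j : 'I_k => B j * 2 ^ j)) => [|j]; first by lia.
by rewrite -val_eqE /= => /negPf ->.
Qed.

(** * Correctness and running time of the program *)

Section Solver.
Variables (w n k : nat) (inp : seq nat).
Hypothesis inp_small : forall a, nth 0 inp a < 2 ^ w.
Hypothesis size_inp : size inp + n + k < 2 ^ w.

(** A block at address [a]. The strict bound keeps all its cells inside the input, so that pointers
    running through it fit in a word. *)
Definition list_at (a : nat) (l : seq nat) : Prop :=
  [/\ a + size l < size inp, nth 0 inp a = size l
    & forall j, j < size l -> nth 0 inp (a + j.+1) = nth 0 l j].

Lemma run_mark_sides s0 a l :
  list_at a l -> regs s0 rOne = 1 -> regs s0 rPtr = a -> regs s0 rLen = size l ->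
  (forall b, cells s0 b = 0) ->
  run w inp mark_sides s0 (size l * 5).+1
    (fun s => same mark_sides s0 s /\ forall b, cells s b = (b \in l)).
Proof.
move=> [a_lt _ nth_l] one_s0 ptr_s0 len_s0 cells0.
pose I i s := regs s rPtr = a + i /\ forall b, cells s b = (b \in take i l).
apply: run_conseq; first apply: (@run_count_down _ _ _ _ _ I (size l)) => //.
- by split; [rewrite ptr_s0 addn0 | move=> b; rewrite take0 cells0].
- move=> i s lt_i [fr _] [ptr_s cells_s].
  have one_s : regs s rOne = 1 by rewrite (fr 1 isT).
  apply: run_step; apply: run_add; rewrite /= ptr_s one_s; first by lia.
  apply: run_step; apply: run_read_input; rewrite //=.
  apply: run_write_mem; rewrite /= one_s -addnA addn1 nth_l //.
  split=> //= b.
  by rewrite cells_s (take_nth 0 lt_i) mem_rcons in_cons; case: eqP.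
- by move=> s [ss [_ c]]; split=> // b; rewrite c take_size.
Qed.

Lemma run_scan_colors s0 a l (d : bool) (B : nat -> bool) :
  list_at a l -> regs s0 rOne = 1 -> regs s0 rN = n ->
  regs s0 rPtr = a -> regs s0 rLen = size l ->
  regs s0 rSide = d -> regs s0 rFlag = 0 ->
  (forall c, c \in l -> c < k) -> (forall j, j < k -> cells s0 (n + j) = B j) ->
  run w inp scan_colors s0 (size l * 10).+1
    (fun s => same scan_colors s0 s /\ regs s rFlag = has (fun c => d (+) B c) l).
Proof.
move=> [a_lt _ nth_l] one_s0 n_s0 ptr_s0 len_s0 side_s0 flag_s0 l_lt bits.
pose I i s := regs s rPtr = a + i /\
  regs s rFlag = has (fun c => d (+) B c) (take i l).
apply: run_conseq; first apply: (@run_count_down _ _ _ _ _ I (size l)) => //.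
- by split; [rewrite ptr_s0 addn0 | rewrite take0].
- move=> i s lt_i [fr mem] [ptr_s flag_s].
  have one_s : regs s rOne = 1 by rewrite (fr 1 isT).
  have n_s : regs s rN = n by rewrite (fr 2 isT).
  have side_s : regs s rSide = d by rewrite (fr 12 isT).
  have ck : nth 0 l i < k by apply/l_lt/mem_nth.
  apply: run_step; apply: run_add; rewrite /= ptr_s one_s; first by lia.
  apply: run_step; apply: run_read_input; rewrite //= -addnA addn1 nth_l //.
  apply: run_step; apply: run_add; rewrite /= n_s; first by lia.
  apply: run_step; apply: run_read_mem; rewrite /= (mem isT) (addnC _ n) bits //.
  apply: (run_seq (T1 := 2) (T2 := 2)).
  (* [Q] holds after either branch of the test on [rSide], so the rest of the round is treated only
     once. *)
  pose Q s' := regs s' rX = (d (+) B (nth 0 l i)) /\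
    forall r, r != rX -> regs s' r = regs (set_reg s rPtr (a + i.+1)) r.
  apply: (@run_conseq _ _ _ _ _ Q) => [|s' [x_s' r_s']].
    apply: run_if => /=; rewrite side_s => d_val.
      apply: run_sub; rewrite /= one_s; split=> /= [|r /negPf -> //].
      by case: (d) d_val; case: (B _).
    apply: run_skip; split=> /= [|r /negPf -> //].
    by case: (d) d_val.
  apply: run_if; rewrite x_s'; last first.
    move=> e; apply: run_skip; split; rewrite /= /= r_s' //= flag_s.
    rewrite (take_nth 0 lt_i) has_rcons.
    by case: (_ (+) _) e.
  move=> e; apply: run_const; first by lia.
  split; rewrite /= /= ?r_s' //=.
  rewrite (take_nth 0 lt_i) has_rcons.
  by case: (_ (+) _) e.
- by move=> s [ss [_ c]]; split=> //; rewrite c take_size.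
Qed.

Variables (nb0 : seq nat) (cs : seq (seq nat)).
Hypothesis input_cols : forall v, v < n -> exists2 a,
  nth 0 inp (2 + n + v) = a & list_at a (nth [::] cs v).
Hypothesis cols_size : forall v, v < n -> size (nth [::] cs v) <= k.
Hypothesis cols_lt : forall v, v < n -> forall c, c \in nth [::] cs v -> c < k.
Hypothesis size_inp_ge : 2 + n + n <= size inp.

(** [B] is the set of colors reserved for the non-neighbors of the vertex 0: a neighbor needs a
    color outside it, a non-neighbor one inside. *)
Definition good_vertex (B : nat -> bool) (v : nat) : bool :=
  has (fun c => (v \in nb0) (+) B c) (nth [::] cs v).

Definition good_below (B : nat -> bool) (i : nat) : bool :=
  all (good_vertex B) (iota 0 i).

Lemma good_belowS B i : good_below B i.+1 = good_below B i && good_vertex B i.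
Proof. by rewrite /good_below -addn1 iotaD all_cat /= andbT. Qed.

Lemma run_scan_vertices s0 (B : nat -> bool) :
  regs s0 rOne = 1 -> regs s0 rN = n -> regs s0 rV = 0 -> regs s0 rLeft = n ->
  regs s0 rAll = 1 ->
  (forall v, v < n -> cells s0 v = (v \in nb0)) ->
  (forall j, j < k -> cells s0 (n + j) = B j) ->
  run w inp scan_vertices s0 (n * (k * 10 + 13)).+1
    (fun s => same scan_vertices s0 s /\ regs s rAll = good_below B n).
Proof.
move=> one_s0 n_s0 v_s0 left_s0 all_s0 sides bits.
pose I i s := regs s rV = i /\ regs s rAll = good_below B i.
apply: run_weaken; first apply: run_conseq.
(* Seven single commands, the scan of at most [k] colors, and three steps for the last test and the
   increment of [rV]. *)
- apply: (@run_count_down _ _ _ _ _ I n (7 + (k * 10 + 1 + 3))) => //.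
  move=> i s lt_i [fr mem] [v_s all_s].
  have one_s : regs s rOne = 1 by rewrite (fr 1 isT).
  have n_s : regs s rN = n by rewrite (fr 2 isT).
  have [a a_eq a_list] := input_cols lt_i.
  have [_ a_size _] := a_list.
  apply: run_step; apply: run_const; rewrite /=; first by lia.
  apply: run_step; apply: run_const; rewrite /=; first by lia.
  apply: run_step; apply: run_add; rewrite /= n_s; first by lia.
  apply: run_step; apply: run_add; rewrite /= v_s; first by lia.
  apply: run_step; apply: run_read_input; rewrite //= a_eq.
  apply: run_step; apply: run_read_input; rewrite //= a_size.
  apply: run_step; apply: run_read_mem; rewrite /= v_s (mem isT) sides //.
  apply: run_seq.
  apply: run_conseq; first apply: (run_weaken (T := (size (nth [::] cs i) * 10).+1)).
  + apply: (run_scan_colors (d := i \in nb0) (B := B) a_list) => //=.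
      exact: cols_lt.
    by move=> j lt_j; rewrite (mem isT) bits.
  + by rewrite addn1 ltnS leq_mul2r cols_size.
  move=> s' [[fr' _] flag].
  have one_s' : regs s' rOne = 1 by rewrite (fr' 1 isT) /=.
  have v_s' : regs s' rV = i by rewrite (fr' 6 isT) /=.
  have all_s' : regs s' rAll = good_below B i.
    by rewrite (fr' 11 isT) /=.
  apply: (run_seq (T1 := 2) (T2 := 1)).
  apply: run_if; rewrite flag => nz.
    apply: run_skip; apply: run_add; rewrite /= v_s' one_s'; first by lia.
    split; rewrite /= ?addn1 // all_s' good_belowS.
    by rewrite /good_vertex; case: (has _ _) nz => //; rewrite andbT.
  apply: run_const; first by lia.
  apply: run_add; rewrite /= v_s' one_s'; first by lia.
  split; rewrite /= ?addn1 // good_belowS.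
  by rewrite /good_vertex; case: (has _ _) nz => //; rewrite andbF.
- by move=> s [ss [_ c]].
- by rewrite ltnS leq_mul2l; apply/orP; right; lia.
Qed.

(** The outgoing carry [c] stands for the bit of weight [2 ^ k], so it is set exactly when the
    counter wraps around. *)
Lemma run_increment s0 (B : nat -> bool) :
  regs s0 rOne = 1 -> regs s0 rZero = 0 -> regs s0 rPtr = n -> regs s0 rLen = k ->
  regs s0 rFlag = 1 ->
  (forall j, j < k -> cells s0 (n + j) = B j) ->
  run w inp increment s0 (k * 10).+1
    (fun s => [/\ same increment s0 s, forall v, v < n -> cells s v = cells s0 v
      & exists (c : bool) (B' : nat -> bool), [/\ regs s rFlag = c,
          forall j, j < k -> cells s (n + j) = B' j
        & bits_val k B' + c * 2 ^ k = (bits_val k B).+1]]).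
Proof.
move=> one_s0 zero_s0 ptr_s0 len_s0 flag_s0 bits.
(* [bits_val + carry * 2 ^ i] is constant during the carry propagation. *)
pose I i s := [/\ regs s rPtr = n + i, forall v, v < n -> cells s v = cells s0 v
  & exists (c : bool) (B' : nat -> bool), [/\ regs s rFlag = c,
      forall j, j < k -> cells s (n + j) = B' j
    & bits_val k B' + c * 2 ^ i = (bits_val k B).+1]].
apply: run_conseq.
- apply: (@run_count_down _ _ _ _ _ I k 8) => //.
    split=> //; first by rewrite addn0.
    by exists true, B; split=> //; rewrite mul1n addn1.
  move=> i s lt_i [fr _] [ptr_s sides_s [c [B' [c_s bits_s val_s]]]].
  have one_s : regs s rOne = 1 by rewrite (fr 1 isT).
  have zero_s : regs s rZero = 0 by rewrite (fr 13 isT).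
  have upd (b : bool) (x : nat) : x = b -> forall j, j < k ->
      (if n + j == n + i then x else cells s (n + j))
      = (fun j => if j == i then b else B' j) j.
    by move=> -> j lt_j; rewrite eqn_add2l; case: eqP => // _; exact: bits_s.
  have upd_side (x v : nat) : v < n ->
      (if v == n + i then x else cells s v) = cells s0 v.
    by move=> lt_v; rewrite sides_s //; case: eqP => //; lia.
  apply: (run_seq (T1 := 6) (T2 := 2)); apply: run_if; rewrite c_s => nz; last first.
    apply: run_skip; apply: run_add; rewrite /= ptr_s one_s; first by lia.
    split; rewrite /= ?addn1 ?addnS //; exists c, B'; split=> //.
    by case: (c) nz val_s.
  have c1 : c = true by case: (c) nz.
  apply: run_step; apply: run_read_mem; rewrite /= ptr_s bits_s //.
  apply: run_if => /= b_i.
    apply: run_write_mem => /=; apply: run_add; rewrite /= ptr_s one_s; first by lia.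
    split; rewrite /= ?ptr_s ?zero_s ?addn1 ?addnS //; first exact: upd_side.
    exists true, (fun j => if j == i then false else B' j); split; first by rewrite c_s c1.
      exact: upd.
    (* Clearing the bit loses [2 ^ i], which the carry gains by moving from weight [2 ^ i] to
       [2 ^ i.+1]. *)
    have := bits_val_update B' false lt_i; move: val_s.
    by rewrite c1 mul1n expnS; case: (B' i) b_i => //= _; lia.
  apply: run_step; apply: run_write_mem => /=.
  apply: run_const => /=; first by lia.
  apply: run_add; rewrite /= ptr_s one_s; first by lia.
  split; rewrite /= ?ptr_s ?one_s ?addn1 ?addnS //; first exact: upd_side.
  exists false, (fun j => if j == i then true else B' j); split=> //.
    exact: upd.
  (* Here the bit was 0 and absorbs the carry. *)
  have := bits_val_update B' true lt_i; move: val_s.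
  by rewrite c1; case: (B' i) b_i => //= _; lia.
- by move=> s [ss [_ sides_s fin]]; split.
Qed.

(** All listed colors are below [k], so the test depends only on the bits that the counter
    stores. *)
Lemma eq_good_below (B B' : nat -> bool) :
  (forall j, j < k -> B j = B' j) -> good_below B n = good_below B' n.
Proof.
move=> eqB; apply: eq_in_all => v; rewrite mem_iota add0n => /= lt_v.
by apply: eq_in_has => c /(cols_lt lt_v)/eqB ->.
Qed.

(** The state after the sets numbered below [m] have been tested; the counter then holds [m]. For
    [m = 2 ^ k] it has overflowed, and nothing is asked of its bits. *)
Definition solver_inv (m : nat) (s : state) : Prop :=
  [/\ regs s rGo = (m < 2 ^ k), forall v, v < n -> cells s v = (v \in nb0),
      m < 2 ^ k -> exists2 B : nat -> bool,
        forall j, j < k -> cells s (n + j) = B j & bits_val k B = m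
    & regs s rAns != 0 <-> exists2 B, bits_val k B < m & good_below B n].

Lemma run_try_subset s m :
  regs s rOne = 1 -> regs s rN = n -> regs s rK = k -> regs s rZero = 0 ->
  m < 2 ^ k -> solver_inv m s ->
  run w inp try_subset s (3 + ((n * (k * 10 + 13)).+1 + (5 + ((k * 10).+1 + 1))))
    (solver_inv m.+1).
Proof.
move=> one_s n_s k_s zero_s lt_m [_ sides /(_ lt_m)[B bits val_B] ans].
apply: run_step; apply: run_const => /=; first by lia.
apply: run_step; apply: run_const => /=; first by lia.
apply: run_step; apply: run_add; rewrite /= n_s zero_s addn0; first by lia.
apply: run_seq; apply: run_conseq; first exact: (run_scan_vertices (B := B)).
move=> s1 [[fr1 mem1] all_s1].
have one_s1 : regs s1 rOne = 1 by rewrite (fr1 1 isT).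
have n_s1 : regs s1 rN = n by rewrite (fr1 2 isT).
have k_s1 : regs s1 rK = k by rewrite (fr1 3 isT).
have zero_s1 : regs s1 rZero = 0 by rewrite (fr1 13 isT).
have ans_s1 : regs s1 rAns = regs s rAns by rewrite (fr1 0 isT).
have cells_s1 : cells s1 = cells s by rewrite (mem1 isT).
apply: (run_seq (T1 := 2) (T2 := 3 + ((k * 10).+1 + 1))).
pose Q s2 := [/\ forall r, r != rAns -> regs s2 r = regs s1 r, cells s2 = cells s &
  regs s2 rAns != 0 <-> exists2 B, bits_val k B < m.+1 & good_below B n].
(* A set numbered at most [m] either is numbered below [m] or agrees with the current [B] on all
   colors. *)
have ansS : (exists2 B, bits_val k B < m.+1 & good_below B n) <->
    good_below B n \/ exists2 B, bits_val k B < m & good_below B n.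
  split=> [[B' le_B' good_B']|[good_B|[B' lt_B' good_B']]].
  - case: (eqVneq (bits_val k B') m) => [eq_m|ne_m]; last by right; exists B'; lia.
    left; rewrite (@eq_good_below B B') //.
    by apply: bits_val_inj; rewrite eq_m.
  - by exists B; rewrite // val_B.
  - by exists B'; lia.
apply: (@run_conseq _ _ _ _ _ Q).
  apply: run_if; rewrite all_s1 => nz.
    apply: run_const => /=; first by lia.
    split=> //= [r /negPf -> //|]; rewrite ansS.
    by split=> // _; left; case: good_below nz.
  apply: run_skip; split=> //; rewrite ansS ans_s1 ans.
  by case: good_below nz => // _; split=> [|[]] //; right.
move=> s2 [fr2 cells_s2 ans_s2].
apply: run_step; apply: run_const => /=; first by lia.
apply: run_step; apply: run_add; rewrite /= !fr2 // n_s1 zero_s1 addn0; first by lia.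
apply: run_step; apply: run_add; rewrite /= !fr2 // k_s1 zero_s1 addn0; first by lia.
apply: run_seq; apply: run_conseq.
  apply: (run_increment (B := B)); rewrite //= ?fr2 //.
  by move=> j lt_j; rewrite cells_s2 bits.
move=> s3 [[fr3 _] sides3 [c [B' [c_s3 bits3 val3]]]].
have lt_B' := bits_val_lt k B'.
apply: run_sub; rewrite c_s3 (fr3 1 isT) /= fr2 // one_s1.
split=> /=.
(* [val3] says that [m.+1] is the new counter value plus [c * 2 ^ k], and that value is below
   [2 ^ k]; hence [1 - c] tells whether [m.+1 < 2 ^ k]. *)
- case: (c) val3; rewrite ?mul1n val_B => val3.
    by rewrite -[m.+1]val3; case: ltnP => //; lia.
  by rewrite -[m.+1]val3 mul0n addn0 lt_B'.
- by move=> v lt_v; rewrite sides3 //= cells_s2 sides.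
- move=> lt_m1; exists B' => //; case: (c) val3; rewrite ?mul1n val_B; lia.
- by rewrite (fr3 0 isT) /=.
Qed.

Hypothesis input_n : nth 0 inp 0 = n.
Hypothesis input_k : nth 0 inp 1 = k.
Hypothesis input_nb0 : exists2 a, nth 0 inp 2 = a & list_at a nb0.
Hypothesis nb0_size : size nb0 <= n.
Hypothesis nb0_lt : forall v, v \in nb0 -> v < n.

Lemma run_solver : 0 < n -> 0 < k ->
  run w inp solver init_state (60 * (2 ^ k * k * n))
    (fun s => regs s rAns != 0 <-> exists B, good_below B n).
Proof.
move=> n_gt0 k_gt0.
have [a a_eq a_list] := input_nb0.
have [_ a_size _] := a_list.
(* As [2 ^ k], [k] and [n] are positive, each term of the expanded cost is at most its coefficient
   times [2 ^ k * k * n]; the coefficients add up to 59. *)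
apply: (run_weaken (T := 6 + ((size nb0 * 5).+1 + (1 + (2 ^ k *
   (3 + ((n * (k * 10 + 13)).+1 + (5 + ((k * 10).+1 + 1)))).+1).+1)))); last first.
  have : 0 < 2 ^ k by rewrite expn_gt0.
  move: (2 ^ k) => P P_gt0; nia.
apply: run_step; apply: run_const => /=; first by lia.
apply: run_step; apply: run_read_input; rewrite //= input_n.
apply: run_step; apply: run_read_input; rewrite //= input_k.
apply: run_step; apply: run_const => /=; first by lia.
apply: run_step; apply: run_read_input; rewrite //= a_eq.
apply: run_step; apply: run_read_input; rewrite //= a_size.
apply: run_seq; apply: run_conseq; first exact: (run_mark_sides a_list).
move=> s [[fr _] cells_s].
have one_s : regs s rOne = 1 by rewrite (fr 1 isT).
have n_s : regs s rN = n by rewrite (fr 2 isT).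
have k_s : regs s rK = k by rewrite (fr 3 isT).
have zero_s : regs s rZero = 0 by rewrite (fr 13 isT).
have ans_s : regs s rAns = 0 by rewrite (fr 0 isT).
apply: run_step; apply: run_const; first by lia.
apply: run_conseq.
- apply: (@run_while _ _ _ _ _ solver_inv (2 ^ k)).
  + split=> //=; first by rewrite expn_gt0.
      move=> _; exists (fun=> false).
        (* All marks lie in cells below [n], so the counter bits are still 0 and represent the empty
           set. *)
        move=> j _; rewrite cells_s; case: (boolP (n + j \in nb0)) => // /nb0_lt.
        by lia.
      by rewrite /bits_val big1 // => j _; rewrite mul0n.
    by rewrite ans_s; split=> // -[].
  + move=> m s' lt_m [fr' _] inv; split; first by case: inv => ->; rewrite lt_m.
    by apply: run_try_subset; rewrite // ?(fr' 1 isT) ?(fr' 2 isT) ?(fr' 3 isT) ?(fr' 13 isT).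
  by move=> s' _ [->]; rewrite ltnn.
move=> s' [_ [_ _ _ ->]]; split=> [[B _ good_B]|[B good_B]]; exists B => //.
exact: bits_val_lt.
Qed.

End Solver.

(** * Complete bipartite graphs *)

Lemma has_walkP (V : finType) (e : rel V) l u v :
  reflect (exists p, [/\ size p = l, path e u p & last u p = v]) (has_walk e l u v).
Proof.
apply: (iffP existsP) => [[p /andP[ep /eqP lp]]|[p [sz ep lp]]].
  by exists p; rewrite size_tuple.
by exists (tcast sz (in_tuple p)); rewrite val_tcast ep lp eqxx.
Qed.

(** A path can be shortened to a duplicate-free one, of length less than [#|V|], so the search in
    [dist] succeeds. *)
Lemma dist_walk (V : finType) (e : rel V) u v :
  connect e u v -> has_walk e (dist e u v) u v.
Proof.
case/connectP=> p ep ->; case/shortenP: ep => p' ep' up' _.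
have le_p' : size p' < #|V| by rewrite -[(size p').+1](card_uniqP up') max_card.
have h : has (fun l => has_walk e l u (last u p')) (iota 0 #|V|).
  apply/hasP; exists (size p'); first by rewrite mem_iota.
  by apply/has_walkP; exists p'.
have := nth_find 0 h; rewrite nth_iota //.
by rewrite has_find size_iota in h.
Qed.

(* Two vertices on opposite sides are joined by a walk of odd length at most 2. *)
Lemma bipartite_diameter2_adj n (e : rel 'I_n) (x : 'I_n) :
  bipartite_diameter_at_most_2 e ->
  forall u v, e u v = (e x u != e x v).
Proof.
move=> [[A bip] diam] u v.
(* Once adjacency means lying on different sides of [A], the side of [x] cancels out of
   [e x u != e x v]. *)
suff adj y z : e y z = ((y \in A) != (z \in A)).
  by rewrite !adj; do 3 case: (_ \in A).
apply/idP/idP=> [/bip //|neqA].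
move: diam; rewrite /diameter_at_most /diameter.
case: ifP => // /forallP/(_ y)/forallP/(_ z) yz diam.
have le2 : dist e y z <= 2.
  apply: leq_trans diam; apply: leq_trans (leq_bigmax y).
  exact: (leq_bigmax z).
have [p [sz ep last_p]] := has_walkP _ _ _ _ (dist_walk yz).
move: le2 ep last_p neqA; rewrite -sz; case: p {sz} => [|a [|b [|//]]] _ /=.
- by move=> _ ->; rewrite eqxx.
- by rewrite andbT => ya <-.
- rewrite andbT => /andP[/bip ya /bip ab] <-.
  by move: ya ab; do 3 case: (_ \in A).
Qed.

(* Read [B c] as "the color [c] is reserved for the non-neighbors of [x]". *)
Lemma complete_bipartite_colorable n k (e : rel 'I_n) (x : 'I_n)
    (L : 'I_n -> {set 'I_k}) :
  (forall u v, e u v = (e x u != e x v)) ->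
  list_colorable e L <->
    exists B : nat -> bool, forall v, exists2 c : 'I_k, c \in L v & e x v (+) B c.
Proof.
move=> adj; split=> [[f [proper fL]]|[B goodB]].
  (* Reserve the colors that [f] uses on non-neighbors of [x]. A neighbor is adjacent to all of
     these vertices and so avoids their colors. *)
  exists (fun c => [exists u, ~~ e x u && (val (f u) == c)]) => v; exists (f v) => //.
  case: (boolP (e x v)) => exv /=; last by apply/existsP; exists v; rewrite exv /=.
  apply/existsPn => u; rewrite negb_and negbK val_eqE.
  case: (boolP (e x u)) => //= exu; apply: proper.
  by rewrite adj exv (negPf exu).
have [f fP] : exists f : 'I_n -> 'I_k, forall v, (f v \in L v) && (e x v (+) B (f v)).
  apply: (fin_all_exists (P := fun v c => (c \in L v) && (e x v (+) B c))) => v.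
  by have [c cL cB] := goodB v; exists c; rewrite cL.
exists f; split=> [u v|v]; last by case/andP: (fP v).
(* A common color of [u] and [v] is either reserved or not, which puts both vertices on the same
   side. *)
rewrite adj; apply: contraNneq => fuv.
have /andP[_] := fP u; have /andP[_] := fP v; rewrite fuv.
by case: (e x u); case: (e x v); case: (B _).
Qed.

(** * The input array *)

Lemma nth_flatten_block (T : Type) (x : T) (ss : seq (seq T)) i j :
  i < size ss -> j < size (nth [::] ss i) ->
  nth x (flatten ss) (sumn (take i (shape ss)) + j) = nth x (nth [::] ss i) j.
Proof.
elim: ss i => [//|s ss IHss] [|i] /=; rewrite ?ltnS => lt_i lt_j.
  by rewrite add0n nth_cat lt_j.
by rewrite -addnA nth_cat ltnNge leq_addr /= addKn IHss.
Qed.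

Section Encode.
Variables (n k : nat) (nbrs : 'I_n -> seq 'I_n) (cols : 'I_n -> seq 'I_k).
Let bs := [seq block (nbrs v) | v <- enum 'I_n] ++
          [seq block (cols v) | v <- enum 'I_n].
Let addr i := 2 + size bs + sumn (take i (shape bs)).

Lemma encodeE :
  encode nbrs cols = [:: n, k & [seq addr i | i <- iota 0 (size bs)] ++ flatten bs].
Proof. by []. Qed.

Lemma size_blocks : size bs = n + n.
Proof. by rewrite size_cat 2!size_map size_enum_ord. Qed.

Lemma size_encode : size (encode nbrs cols) = 2 + size bs + sumn (shape bs).
Proof. by rewrite encodeE /= size_cat size_map size_iota size_flatten. Qed.

Lemma nth_encode_addr i : i < n + n -> nth 0 (encode nbrs cols) (2 + i) = addr i.
Proof.
move=> lt_i; rewrite encodeE /= nth_cat size_map size_iota size_blocks lt_i.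
by rewrite (nth_map 0) ?size_iota ?size_blocks // nth_iota // size_blocks.
Qed.

Lemma nth_encode_block i j : i < n + n -> j < size (nth [::] bs i) ->
  nth 0 (encode nbrs cols) (addr i + j) = nth 0 (nth [::] bs i) j.
Proof.
move=> lt_i lt_j; rewrite encodeE /addr -!addnA /= add0n.
rewrite nth_cat size_map size_iota ltnNge leq_addr /= addKn.
by rewrite nth_flatten_block // size_blocks.
Qed.

Lemma sum_shape_block i : i < n + n ->
  sumn (take i (shape bs)) + size (nth [::] bs i) <= sumn (shape bs).
Proof.
move=> lt_i; rewrite -{2}(cat_take_drop i (shape bs)) sumn_cat leq_add2l.
rewrite (drop_nth 0) ?size_map ?size_blocks //= /shape (nth_map [::]) ?size_blocks //.
exact: leq_addr.
Qed.

Lemma list_at_block i m (s : seq 'I_m) : i < n + n -> nth [::] bs i = block s ->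
  list_at (encode nbrs cols) (addr i) (map val s).
Proof.
move=> lt_i bs_i; have := sum_shape_block lt_i; rewrite bs_i /= size_map => le_s.
split.
- by rewrite size_map size_encode /addr; lia.
- by rewrite -[addr i]addn0 nth_encode_block ?bs_i ?size_map.
- by move=> j lt_j; rewrite nth_encode_block ?bs_i // ltnS.
Qed.

Lemma nth_blocks_nbrs (v : 'I_n) : nth [::] bs v = block (nbrs v).
Proof.
by rewrite nth_cat size_map size_enum_ord ltn_ord (nth_map v) ?size_enum_ord ?nth_ord_enum.
Qed.

Lemma nth_blocks_cols (v : 'I_n) : nth [::] bs (n + v) = block (cols v).
Proof.
rewrite nth_cat size_map size_enum_ord ltnNge leq_addr /= addKn.
by rewrite (nth_map v) ?size_enum_ord ?nth_ord_enum.
Qed.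

Hypothesis nbrs_uniq : forall v, uniq (nbrs v).
Hypothesis cols_uniq : forall v, uniq (cols v).

Lemma uniq_ord_size m (s : seq 'I_m) : uniq s -> size s <= m.
Proof. by move/card_uniqP <-; rewrite -[leqRHS]card_ord max_card. Qed.

Lemma sumn_shape_blocks : sumn (shape bs) <= n * n.+1 + n * k.+1.
Proof.
rewrite /bs /shape map_cat sumn_cat -2!map_comp 2!sumnE 2!big_map 2!big_enum /=.
by apply: leq_add; rewrite -[leqRHS]/(n * _) -[X in X * _]card_ord -sum_nat_const;
   apply: leq_sum => v _; rewrite /= size_map ltnS uniq_ord_size.
Qed.

(** Addresses are bounded by the size of the input, all other entries by [n] or [k]. Together with
    [encode_bound], this shows that reading the input never truncates a value. *)
Lemma encode_le a : nth 0 (encode nbrs cols) a <= size (encode nbrs cols) + n + k.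
Proof.
case: (ltnP a (size (encode nbrs cols))) => [lt_a|]; last by move/(nth_default 0)->.
have := mem_nth 0 lt_a; move: (nth _ _ _) => x.
rewrite size_encode encodeE !inE mem_cat => /or4P[/eqP->|/eqP->||]; try lia.
  case/mapP=> i; rewrite mem_iota size_blocks add0n => /= lt_i ->.
  by rewrite /addr size_blocks; have := sum_shape_block lt_i; lia.
case/flattenP=> b; rewrite mem_cat => /orP[] /mapP[v _ ->] /=; rewrite in_cons.
  case/orP=> [/eqP->|/mapP[u _ ->]]; first by have := uniq_ord_size (nbrs_uniq v); lia.
  by have := ltn_ord u; rewrite /=; lia.
case/orP=> [/eqP->|/mapP[u _ ->]]; first by have := uniq_ord_size (cols_uniq v); lia.
by have := ltn_ord u; rewrite /=; lia.
Qed.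

Lemma encode_bound w : 0 < n -> 0 < k -> (n + k) ^ 5 <= 2 ^ w ->
  size (encode nbrs cols) + n + k < 2 ^ w.
Proof.
move=> n_gt0 k_gt0; apply: leq_trans; rewrite size_encode size_blocks.
have S_le := sumn_shape_blocks; have x_ge2 : 2 <= n + k by lia.
have : sumn (shape bs) <= (n + k) ^ 2 + 2 * (n + k) by nia.
(* The input size is quadratic in [n + k]. Three further factors, each at least 2, absorb the
   constants; hence the exponent 5. *)
have : 2 ^ 3 * (n + k) ^ 2 <= (n + k) ^ 5.
  by rewrite (expnD _ 3 2) leq_mul2r leq_exp2r ?x_ge2 ?orbT.
have : 2 * (n + k) <= (n + k) ^ 2 by rewrite leq_mul2r x_ge2 orbT.
lia.
Qed.
End Encode.

(** * The resulting decision procedure *)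

Lemma solver_correct k : 0 < k ->
  solves_list_coloring bipartite_diameter_at_most_2 k solver 5
    (fun n => 60 * (2 ^ k * k * n)).
Proof.
move=> k_gt0 n e L nbrs cols w n_gt0 simple cls nbrsP colsP word.
pose x := Ordinal n_gt0.
pose cs := [seq map val (cols v) | v <- enum 'I_n].
have nbrs_uniq v : uniq (nbrs v) by case: (nbrsP v).
have cols_uniq v : uniq (cols v) by case: (colsP v).
have csE (v : 'I_n) : nth [::] cs v = map val (cols v).
  by rewrite (nth_map v) ?size_enum_ord ?nth_ord_enum.
have bound := encode_bound nbrs_uniq cols_uniq n_gt0 k_gt0 word.
have [t [s [ex le_t ans]]] : run w (encode nbrs cols) solver init_state
    (60 * (2 ^ k * k * n))
    (fun s => regs s rAns != 0 <-> exists B, good_below (map val (nbrs x)) cs B n).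
  apply: run_solver => //.
  - by move=> a; apply: leq_ltn_trans bound; exact: encode_le.
  - move=> v lt_v; rewrite -[v]/(val (Ordinal lt_v)) csE -addnA.
    eexists; first by apply: nth_encode_addr; rewrite ltn_add2l.
    by apply: list_at_block; rewrite ?ltn_add2l // nth_blocks_cols.
  - move=> v lt_v; rewrite -[v]/(val (Ordinal lt_v)) csE size_map.
    exact: uniq_ord_size.
  - move=> v lt_v c; rewrite -[v]/(val (Ordinal lt_v)) csE.
    by case/mapP=> c' _ ->; exact: ltn_ord.
  - by rewrite size_encode size_blocks; lia.
  (* Cell [2 + 0] holds the address of the adjacency list of the vertex 0, which is [x]. *)
  - eexists; first by apply: (@nth_encode_addr _ _ _ _ 0); lia.
    by apply: list_at_block; [lia | rewrite (nth_blocks_nbrs _ _ x)].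
  - by rewrite size_map uniq_ord_size.
  - by move=> v /mapP[u _ ->]; exact: ltn_ord.
exists t, s; split=> //; apply: (iff_trans ans).
apply: iff_sym; apply: (iff_trans (complete_bipartite_colorable _ _)).
  exact: bipartite_diameter2_adj x cls.
have goodE B (v : 'I_n) : good_vertex (map val (nbrs x)) cs B v
    <-> exists2 c : 'I_k, c \in L v & e x v (+) B c.
  have [_ nbrsE] := nbrsP x; have [_ colsE] := colsP v.
  rewrite /good_vertex csE has_map (mem_map val_inj) nbrsE.
  split=> [/hasP[c]|[c cL cB]]; first by rewrite colsE; exists c.
  by apply/hasP; exists c; rewrite ?colsE.
split=> -[B goodB]; exists B.
  apply/allP=> v; rewrite mem_iota add0n => /= lt_v.
  exact/(goodE B (Ordinal lt_v)).
move=> v; apply/goodE; apply: (allP goodB).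
by rewrite mem_iota add0n /=.
Qed.

Theorem theorem2 :
  (exists (p : cmd) (c C : nat), forall k : nat, 0 < k ->
     solves_list_coloring bipartite_diameter_at_most_2 k p c
       (fun n => C * (2 ^ k * k * log_ge1 k * n)))
  /\
  (forall k : nat, 0 < k -> exists (p : cmd) (c C : nat),
     solves_list_coloring bipartite_diameter_at_most_2 k p c
       (fun n => C * n)).
Proof.
split=> [|k k_gt0].
  exists solver, 5, 60 => k k_gt0 n e L nbrs cols w n_gt0 simple cls nbrsP colsP word.
  have [t [s [ex le_t ans]]] := solver_correct k_gt0 n_gt0 simple cls nbrsP colsP word.
  exists t, s; split=> //; apply: leq_trans le_t _.
  (* The factor [log_ge1 k] is at least 1, so inserting it only weakens the bound. *)
  by rewrite leq_mul2l leq_mul2r leq_pmulr ?orbT // leq_max.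
(* For fixed [k] the whole factor in front of [n] is a constant. *)
exists solver, 5, (60 * (2 ^ k * k)) => n e L nbrs cols w n_gt0 simple cls nbrsP colsP word.
have [t [s [ex le_t ans]]] := solver_correct k_gt0 n_gt0 simple cls nbrsP colsP word.
by exists t, s; split=> //; rewrite -mulnA.
Qed.
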